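(* Let $J$ be a set with $|J|\ge2$, let $D$ be a unital alternative $k$-algebra, assumed associative if $|J|\ge3$, and let $V=\mathbf M(\{1\},J,D)$. The $k$-module $\mathfrak{uider}(V)_0$ is isomorphic to $$\frac{(D\otimes D)\oplus\bigoplus_{j\in J}D_j}{U},$$ where $D_j$ ($j\in J$) are copies of $D$ (write $d_j$ for the copy of $d\in D$ in $D_j$) and $U$ is the submodule generated by the elements $$a\otimes b+b\otimes a,\qquad ab\otimes c+bc\otimes a+ca\otimes b-(a,b,c)_{j_0}-(a,b,c)_j$$ for $a,b,c\in D$ and distinct $j,j_0\in J$. Here $(a,b,c)=(ab)c-a(bc)$ denotes the associator.
   Context: $k$ is a commutative associative unital ring; tensor products are over $k$. The rectangular matrix Jordan pair $V=\mathbf M(\{1\},J,D)$ is $(V^+,V^-)=(\mathrm{Mat}(1,J,D),\mathrm{Mat}(J,1,D))$ (row, resp. column, matrices with finitely many nonzero entries in $D$) with $Q_x(y)=xyx$ and triple products $\{x\,y\,z\}=x(yz)+z(yx)$, $\{y\,x\,w\}=(yx)w+(wx)y$ for $x,z\in V^+$, $y,w\in V^-$. $E_{1j}a\in V^+$ and $E_{j1}b\in V^-$ denote the matrices with the single entry $a$, resp. $b$, in position $j\in J$. For a Jordan pair $V$, $\mathfrak{uider}(V)=(V^+\otimes V^-)/I(V)$, where $I(V)$ is the submodule generated by the elements $\delta(x,y)(u\otimes w)+\delta(u,w)(x\otimes y)$ and $\delta(x,y)(x\otimes y)$ for $x,u\in V^+$, $y,w\in V^-$, with $\delta(x,y)(u\otimes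 w)=\{x\,y\,u\}\otimes w-u\otimes\{y\,x\,w\}$. The class of $x\otimes y$ is written $x\diamond y$. For $V=\mathbf M(\{1\},J,D)$, $\mathfrak{uider}(V)_0$ is the submodule spanned by all $E_{1j}a\diamond E_{j1}b$ with $j\in J$, $a,b\in D$ (the degree-zero component for the root lattice grading of $\mathfrak{uider}(V)$ in which $E_{1i}a\diamond E_{j1}b$ has degree $\varepsilon_j-\varepsilon_i$). *)

(* Defs.v *)
From HB Require Import structures.
From mathcomp Require Import all_boot all_order all_algebra.
From mathcomp Require Import finmap generic_quotient ring_quotient.
From mathcomp Require Import boolp classical_sets functions cardinality fsbigop.

Set Implicit Arguments.
Unset Strict Implicit.
Unset Printing Implicit Defensive.

Import GRing.Theory.
Local Open Scope classical_set_scope.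
Local Open Scope ring_scope.
Local Open Scope quotient_scope.

Declare Scope tensor_scope.
Reserved Notation "x ⊗ y" (at level 38, left associativity).
Reserved Notation "x ∙ y" (at level 40, left associativity).

Section GeneratedSubmodule.
Variables (k : pzRingType) (V : lmodType k).

Definition submod_gen (A : set V) : {pred V} :=
  fun x => `[< forall S : submodClosed V, (forall a, A a -> a \in S) -> x \in S >].

Lemma submod_genP (A : set V) x : reflect
  (forall S : submodClosed V, (forall a, A a -> a \in S) -> x \in S)
  (x \in submod_gen A).
Proof. exact: asboolP. Qed.

Lemma mem_submod_gen (A : set V) a : A a -> a \in submod_gen A.
Proof. by move=> Aa; apply/submod_genP => S; apply. Qed.

Lemma submod_gen_closed (A : set V) : submod_closed (submod_gen A).
Proof.
split=> [|c x y /submod_genP Ax /submod_genP Ay]; apply/submod_genP => S AS.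
  exact: rpred0.
by rewrite rpredD ?rpredZ ?Ax ?Ay.
Qed.

HB.instance Definition _ (A : set V) :=
  GRing.isSubmodClosed.Build k V (submod_gen A) (submod_gen_closed A).

End GeneratedSubmodule.

Section Submodule.
Variables (k : pzRingType) (V : lmodType k) (S : submodClosed V).

Record submod := Submod { submod_val :> V; _ : submod_val \in S }.

HB.instance Definition _ := [isSub for submod_val].
HB.instance Definition _ := [Choice of submod by <:].
HB.instance Definition _ := [SubChoice_isSubLmodule of submod by <:].

End Submodule.

Section QuotientModule.
Variables (k : pzRingType) (V : lmodType k) (S : submodClosed V).

(* An additive-subgroup structure is needed by Quotient.quot. *)
Definition submod_pred : {pred V} := fun x => x \in S.

Fact submod_pred_zmod_closed : zmod_closed submod_pred.
Proof.
split=> [|x y xS yS]; first exact: (rpred0 S).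
by rewrite unfold_in -scaleN1r (rpredD (xS : x \in S)) // (rpredZ _ (yS : y \in S)).
Qed.

HB.instance Definition _ :=
  GRing.isZmodClosed.Build V submod_pred submod_pred_zmod_closed.

Definition quotmod : Type := Quotient.quot submod_pred.

HB.instance Definition _ := GRing.Zmodule.on quotmod.

Definition to_quot (x : V) : quotmod := \pi_(Quotient.quot submod_pred) x.

Lemma to_quot_eq x y : (to_quot x = to_quot y) <-> (x - y \in S).
Proof.
have -> : (x - y \in S) = (x - y \in submod_pred) by [].
by rewrite Quotient.idealrBE; split=> /eqP.
Qed.

Lemma to_quot_surj (q : quotmod) : exists x, to_quot x = q.
Proof. by exists (repr (q : Quotient.quot submod_pred)); exact: reprK. Qed.

Lemma to_quotD : {morph to_quot : x y / x + y}.
Proof. exact: Quotient.pi_add. Qed.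

Definition quot_scale (c : k) (q : quotmod) : quotmod :=
  to_quot (c *: repr (q : Quotient.quot submod_pred)).

Lemma to_quotZ c x : to_quot (c *: x) = quot_scale c (to_quot x).
Proof.
apply/to_quot_eq; rewrite -scalerBr rpredZ //.
by apply/to_quot_eq; rewrite /to_quot reprK.
Qed.

Fact quot_scaleA a b q :
  quot_scale a (quot_scale b q) = quot_scale (a * b) q.
Proof. by have [x <-] := to_quot_surj q; rewrite -!to_quotZ scalerA. Qed.

Fact quot_scale1 : left_id 1 quot_scale.
Proof. by move=> q; have [x <-] := to_quot_surj q; rewrite -to_quotZ scale1r. Qed.

Fact quot_scaleDr : right_distributive quot_scale +%R.
Proof.
move=> c p q; have [x <-] := to_quot_surj p; have [y <-] := to_quot_surj q.
by rewrite -to_quotD -!to_quotZ -to_quotD scalerDr.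
Qed.

Fact quot_scaleDl q : {morph quot_scale^~ q : a b / a + b}.
Proof.
move=> a b; have [x <-] := to_quot_surj q.
by rewrite -!to_quotZ -to_quotD scalerDl.
Qed.

HB.instance Definition _ := GRing.Zmodule_isLmodule.Build k quotmod
  quot_scaleA quot_scale1 quot_scaleDr quot_scaleDl.

Fact to_quot_is_linear : linear to_quot.
Proof. by move=> c x y; rewrite to_quotD to_quotZ. Qed.

HB.instance Definition _ :=
  GRing.isLinear.Build k V quotmod _ to_quot to_quot_is_linear.

End QuotientModule.

Section FiniteSupport.
Variables (k : pzRingType) (T : choiceType) (M : lmodType k).

Definition finite_supp : {pred T -> M} :=
  fun f => `[< finite_set [set t | f t != 0] >].

Lemma finite_suppP (f : T -> M) :
  reflect (finite_set [set t | f t != 0]) (f \in finite_supp).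
Proof. exact: asboolP. Qed.

Fact finite_supp_submod_closed : submod_closed finite_supp.
Proof.
split=> [|c f g /finite_suppP ff /finite_suppP fg]; apply/finite_suppP.
  by apply: (sub_finite_set _ (finite_set0 T)) => t /= /eqP; apply.
have /sub_finite_set : [set t | (c *: f + g) t != 0] `<=`
    [set t | f t != 0] `|` [set t | g t != 0].
  move=> t /=; apply: contraPP => /not_orP[/negP/negPn/eqP f0 /negP/negPn/eqP g0].
  by apply/negP; rewrite negbK; apply/eqP;
     rewrite addrfctE scalrfctE f0 g0 scaler0 addr0.
by apply; rewrite finite_setU.
Qed.

HB.instance Definition _ := GRing.isSubmodClosed.Build k (T -> M) finite_supp
  finite_supp_submod_closed.

(* The direct sum of copies of M indexed by T. *)
Definition finsupp : lmodType k := submod finite_supp.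

Fact single_subproof (t : T) (m : M) :
  (fun u => if u == t then m else 0) \in finite_supp.
Proof.
apply/finite_suppP; apply: (sub_finite_set _ (finite_set1 t)) => u /=.
by case: (u =P t) => // _ /eqP.
Qed.

Definition single (t : T) (m : M) : finsupp := Submod (single_subproof t m).

Definition entry (x : finsupp) : T -> M := submod_val x.

Lemma entry_finite (x : finsupp) : finite_set [set t | entry x t != 0].
Proof. exact/finite_suppP/(valP x). Qed.

Lemma finsupp_eq (x y : finsupp) : entry x =1 entry y -> x = y.
Proof. by move=> xy; apply/val_inj/funext. Qed.

Lemma entryD (x y : finsupp) t : entry (x + y) t = entry x t + entry y t.
Proof. by []. Qed.

Lemma entryN (x : finsupp) t : entry (- x) t = - entry x t.
Proof. exact: (congr1 (fun f => f t) (raddfN (val : finsupp -> _) x)). Qed.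

End FiniteSupport.

Section Tensor.
Variables (k : comPzRingType) (M N : lmodType k).

Local Notation free := (finsupp (M * N)%type k^o).
Local Notation "[ x , y ]" := (single (x, y) (1 : k^o) : free).

Definition tens_rel : set free :=
  [set t | exists x x' y, t = [x + x', y] - [x, y] - [x', y]] `|`
  [set t | exists x y y', t = [x, y + y'] - [x, y] - [x, y']] `|`
  [set t | exists (c : k) x y, t = [c *: x, y] - c *: [x, y]] `|`
  [set t | exists (c : k) x y, t = [x, c *: y] - c *: [x, y]].

Definition tens : lmodType k := quotmod (submod_gen tens_rel).

Definition tpure (x : M) (y : N) : tens := to_quot _ [x, y].

End Tensor.

Notation "x ⊗ y" := (tpure x y) : tensor_scope.
Local Open Scope tensor_scope.

Section TensorFacts.
Variables (k : comPzRingType) (M N : lmodType k).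
Implicit Types (x : M) (y : N).

Lemma tpureDl x x' y : (x + x') ⊗ y = x ⊗ y + x' ⊗ y.
Proof.
rewrite /tpure -linearD; apply/to_quot_eq/mem_submod_gen; rewrite opprD addrA.
by left; left; left; exists x, x', y.
Qed.

Lemma tpureDr x y y' : x ⊗ (y + y') = x ⊗ y + x ⊗ y'.
Proof.
rewrite /tpure -linearD; apply/to_quot_eq/mem_submod_gen; rewrite opprD addrA.
by left; left; right; exists x, y, y'.
Qed.

Lemma tpureZl (c : k) x y : (c *: x) ⊗ y = c *: (x ⊗ y).
Proof.
rewrite /tpure -linearZ; apply/to_quot_eq/mem_submod_gen.
by left; right; exists c, x, y.
Qed.

Lemma tpureZr (c : k) x y : x ⊗ (c *: y) = c *: (x ⊗ y).
Proof.
rewrite /tpure -linearZ; apply/to_quot_eq/mem_submod_gen.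
by right; exists c, x, y.
Qed.

End TensorFacts.

HB.mixin Record Lmodule_isUnitalNonassocAlgebra (k : comPzRingType) D
    of GRing.Lmodule k D := {
  nmul : D -> D -> D;
  none : D;
  nmulDl : forall a b c : D, nmul (a + b) c = nmul a c + nmul b c;
  nmulDr : forall a b c : D, nmul a (b + c) = nmul a b + nmul a c;
  nmulZl : forall (r : k) (a b : D), nmul (r *: a) b = r *: nmul a b;
  nmulZr : forall (r : k) (a b : D), nmul a (r *: b) = r *: nmul a b;
  nmul1l : forall a : D, nmul none a = a;
  nmul1r : forall a : D, nmul a none = a
}.

#[short(type="nonassocAlgType")]
HB.structure Definition UnitalNonassocAlgebra (k : comPzRingType) :=
  {D of Lmodule_isUnitalNonassocAlgebra k D & GRing.Lmodule k D}.

Notation "x ∙ y" := (nmul x y) : tensor_scope.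

Section Alternative.
Variables (k : comPzRingType) (D : nonassocAlgType k).

Definition associator (a b c : D) : D := (a ∙ b) ∙ c - a ∙ (b ∙ c).

Definition alternative : Prop :=
  forall a b : D, associator a a b = 0 /\ associator b a a = 0.

Lemma nmul0l (a : D) : 0 ∙ a = 0.
Proof. by have := nmulZl 0 0 a; rewrite !scale0r. Qed.

Lemma nmul0r (a : D) : a ∙ 0 = 0.
Proof. by have := nmulZr 0 a 0; rewrite !scale0r. Qed.

End Alternative.

(* The data (V^+, V^-, Q) of a Jordan pair: uider only depends on the triple
   products, obtained by polarizing Q, so the Jordan identities are not part
   of the structure. *)
Record quadPair (k : comPzRingType) := QuadPair {
  Vpos : lmodType k;
  Vneg : lmodType k;
  Qpos : Vpos -> Vneg -> Vpos;
  Qneg : Vneg -> Vpos -> Vneg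
}.

Section Uider.
Variables (k : comPzRingType) (V : quadPair k).

Definition triple_pos (x : Vpos V) (y : Vneg V) (z : Vpos V) : Vpos V :=
  Qpos (x + z) y - Qpos x y - Qpos z y.

Definition triple_neg (y : Vneg V) (x : Vpos V) (w : Vneg V) : Vneg V :=
  Qneg (y + w) x - Qneg y x - Qneg w x.

(* delta x y u w is δ(x,y)(u ⊗ w) *)
Definition delta (x : Vpos V) (y : Vneg V) (u : Vpos V) (w : Vneg V) :
    tens (Vpos V) (Vneg V) :=
  triple_pos x y u ⊗ w - u ⊗ triple_neg y x w.

Definition uider_rel : set (tens (Vpos V) (Vneg V)) :=
  [set t | exists x y u w, t = delta x y u w + delta u w x y] `|`
  [set t | exists x y, t = delta x y x y].

Definition uider : lmodType k := quotmod (submod_gen uider_rel).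

Definition diamond (x : Vpos V) (y : Vneg V) : uider := to_quot _ (x ⊗ y).

End Uider.

Section MatrixPair.
Variables (k : comPzRingType) (J : choiceType) (D : nonassocAlgType k).

(* Both Mat(1,J,D) and Mat(J,1,D) are encoded by finsupp J D; E_{1j}a and
   E_{j1}b are single j a and single j b. *)
Implicit Types (x z : finsupp J D) (y w : finsupp J D).

Fact row_mul_subproof x y z :
  (fun j => \sum_(i \in [set: J]) (entry x i ∙ (entry y i ∙ entry z j)))
    \in @finite_supp k J D.
Proof.
apply/finite_suppP.
have := entry_finite z; apply: sub_finite_set => j /=.
apply: contra_neq => z0; rewrite fsbig1 // => i _.
by rewrite z0 !nmul0r.
Qed.

(* x(yz) for rows x, z and a column y: yz is a J×J-matrix. For nonassociative
   D this differs from (xy)z. *)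
Definition row_mul x y z : finsupp J D := Submod (row_mul_subproof x y z).

Fact col_mul_subproof y x w :
  (fun i => \sum_(j \in [set: J]) ((entry y i ∙ entry x j) ∙ entry w j))
    \in @finite_supp k J D.
Proof.
apply/finite_suppP.
have := entry_finite y; apply: sub_finite_set => j /=.
apply: contra_neq => y0; rewrite fsbig1 // => i _.
by rewrite y0 !nmul0l.
Qed.

(* (yx)w for columns y, w and a row x *)
Definition col_mul y x w : finsupp J D := Submod (col_mul_subproof y x w).

Definition rectPair : quadPair k :=
  @QuadPair k (finsupp J D) (finsupp J D)
    (fun x y => row_mul x y x) (fun y x => col_mul y x y).

Lemma finite_entry x (F : J -> D) :
  (forall i, entry x i = 0 -> F i = 0) ->
  finite_set ([set: J] `&` F @^-1` [set~ 0]).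
Proof.
move=> xF; have := entry_finite x; apply: sub_finite_set => i [_ /=] F0.
by apply/eqP => x0; apply: F0; exact: xF.
Qed.

Lemma fsum_split (F G : J -> D) :
  finite_set ([set: J] `&` F @^-1` [set~ 0]) ->
  finite_set ([set: J] `&` G @^-1` [set~ 0]) ->
  \sum_(i \in [set: J]) (F i + G i) =
  \sum_(i \in [set: J]) F i + \sum_(i \in [set: J]) G i.
Proof.
move=> finF finG; set A := _ `&` _ in finF; set B := _ `&` _ in finG.
have F0 i : ~ (A `|` B) i -> F i = 0.
  by move=> nAB; apply: contrapT => Fi; apply: nAB; left.
have G0 i : ~ (A `|` B) i -> G i = 0.
  by move=> nAB; apply: contrapT => Gi; apply: nAB; right.
have toAB H : (forall i, ~ (A `|` B) i -> H i = 0) ->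
    \sum_(i \in [set: J]) H i = \sum_(i \in A `|` B) H i :> D.
  move=> H0; apply/esym/fsbig_widen => // i [_ /=]; exact: H0.
rewrite !toAB ?fsbig_split ?finite_setU // => i nAB.
by rewrite F0 // G0 // addr0.
Qed.

Lemma row_mulE x y z j : entry (row_mul x y z) j =
  \sum_(i \in [set: J]) (entry x i ∙ (entry y i ∙ entry z j)).
Proof. by []. Qed.

Lemma col_mulE y x w i : entry (col_mul y x w) i =
  \sum_(j \in [set: J]) ((entry y i ∙ entry x j) ∙ entry w j).
Proof. by []. Qed.

Lemma row_mulDl x x' y z : row_mul (x + x') y z = row_mul x y z + row_mul x' y z.
Proof.
apply: finsupp_eq => j; rewrite entryD !row_mulE -fsum_split.
- by apply: eq_fsbigr => i _; rewrite entryD nmulDl.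
- by apply: (finite_entry (x := x)) => i ->; rewrite nmul0l.
- by apply: (finite_entry (x := x')) => i ->; rewrite nmul0l.
Qed.

Lemma row_mulDr x y z z' : row_mul x y (z + z') = row_mul x y z + row_mul x y z'.
Proof.
apply: finsupp_eq => j; rewrite entryD !row_mulE -fsum_split.
- by apply: eq_fsbigr => i _; rewrite entryD !nmulDr.
- by apply: (finite_entry (x := x)) => i ->; rewrite nmul0l.
- by apply: (finite_entry (x := x)) => i ->; rewrite nmul0l.
Qed.

Lemma col_mulDl y y' x w : col_mul (y + y') x w = col_mul y x w + col_mul y' x w.
Proof.
apply: finsupp_eq => i; rewrite entryD !col_mulE -fsum_split.
- by apply: eq_fsbigr => j _; rewrite entryD !nmulDl.
- by apply: (finite_entry (x := w)) => j ->; rewrite nmul0r.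
- by apply: (finite_entry (x := w)) => j ->; rewrite nmul0r.
Qed.

Lemma col_mulDr y x w w' : col_mul y x (w + w') = col_mul y x w + col_mul y x w'.
Proof.
apply: finsupp_eq => i; rewrite entryD !col_mulE -fsum_split.
- by apply: eq_fsbigr => j _; rewrite entryD nmulDr.
- by apply: (finite_entry (x := w)) => j ->; rewrite nmul0r.
- by apply: (finite_entry (x := w')) => j ->; rewrite nmul0r.
Qed.

Lemma triple_pos_rect x y z :
  triple_pos (V := rectPair) x y z = row_mul x y z + row_mul z y x.
Proof.
rewrite /triple_pos /= row_mulDl !row_mulDr.
by rewrite addrAC addrA addrK addrC !addrA addNr add0r.
Qed.

Lemma triple_neg_rect y x w :
  triple_neg (V := rectPair) y x w = col_mul y x w + col_mul w x y.
Proof.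
rewrite /triple_neg /= col_mulDl !col_mulDr.
by rewrite addrAC addrA addrK addrC !addrA addNr add0r.
Qed.

Definition uider0 : lmodType k :=
  submod (submod_gen [set d : uider rectPair | exists (j : J) (a b : D),
    d = diamond (V := rectPair) (single j a) (single j b)]).

Definition Urel : set (tens D D * finsupp J D)%type :=
  [set t | exists a b : D, t = (a ⊗ b + b ⊗ a, 0)] `|`
  [set t | exists (a b c : D) (j j0 : J), j <> j0 /\
    t = ((a ∙ b) ⊗ c + (b ∙ c) ⊗ a + (c ∙ a) ⊗ b,
         - single j0 (associator a b c) - single j (associator a b c))].

End MatrixPair.

(* Main.v *)
From HB Require Import structures.
From mathcomp Require Import all_boot all_order all_algebra.
From mathcomp Require Import finmap.
From mathcomp Require Import boolp classical_sets functions cardinality fsbigop.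
Require Import Defs.
Set Implicit Arguments.
Unset Strict Implicit.
Unset Printing Implicit Defensive.
Import GRing.Theory.
Local Open Scope fset_scope.
Local Open Scope ring_scope.
Local Open Scope tensor_scope.

(** Write [a,b]_j for E_{1j}a ⋄ E_{j1}b. The isomorphism sends [a,b]_j to
    a ⊗ b + (ba)_j; its inverse sends a ⊗ b to [a,b]_j - [ba,1]_j, which does
    not depend on j, and d_j to [d,1]_j. The defining relations of uider only
    give something in degree zero when their indices pair up in one of two
    ways, and each pairing gives an instance of the cyclic relation in U. When
    all indices coincide both contribute, and the associators cancel because
    (a,bc,d) + (c,da,b) + (c,ba,d) + (a,dc,b) = 0 in an alternative algebra,
    which holds since Kleinfeld's function is alternating. *)

(** * Linear identities in abelian groups, by reflection *)

Inductive zexpr := ZVar of nat | ZZero | ZOpp of zexpr | ZAdd of zexpr & zexpr.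

Fixpoint zeval (V : zmodType) (env : seq V) (e : zexpr) : V :=
  match e with
  | ZVar i => env`_i
  | ZZero => 0
  | ZOpp e1 => - zeval env e1
  | ZAdd e1 e2 => zeval env e1 + zeval env e2
  end.

Fixpoint zcoef (e : zexpr) (i : nat) : int :=
  match e with
  | ZVar j => (i == j)%:R
  | ZZero => 0
  | ZOpp e1 => - zcoef e1 i
  | ZAdd e1 e2 => zcoef e1 i + zcoef e2 i
  end.

Lemma zeval_coef (V : zmodType) (env : seq V) e :
  zeval env e = \sum_(i < size env) env`_i *~ zcoef e i.
Proof.
elim: e => [j||e IHe|e1 IH1 e2 IH2] /=.
- case: (ltnP j (size env)) => [lt_j|le_j].
    rewrite (bigD1 (Ordinal lt_j)) //= eqxx big1 ?addr0 // => i.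
    by rewrite -val_eqE => /negPf /= ->.
  (* An index beyond [env] evaluates to the default [0], and on the right every coefficient
     vanishes. *)
  rewrite nth_default // big1 // => i _.
  by rewrite ltn_eqF // (leq_trans (ltn_ord i)).
- by rewrite big1.
- by rewrite IHe -sumrN; apply: eq_bigr => i _; rewrite mulrNz.
- by rewrite IH1 IH2 -big_split; apply: eq_bigr => i _; rewrite mulrzDr.
Qed.

Lemma zeval_eq (V : zmodType) (env : seq V) e1 e2 :
  all (fun i => zcoef e1 i == zcoef e2 i) (iota 0 (size env)) ->
  zeval env e1 = zeval env e2.
Proof.
move=> /allP e12; rewrite !zeval_coef; apply: eq_bigr => i _.
by rewrite (eqP (e12 i _)) // mem_iota ltn_ord.
Qed.

Ltac zatom x env :=
  lazymatch env with
  | cons x _ => env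
  | cons ?y ?env1 => let env2 := zatom x env1 in constr:(cons y env2)
  | _ => constr:(cons x env)
  end.

Ltac zatoms t env :=
  lazymatch t with
  | @GRing.zero _ => env
  | @GRing.opp _ ?a => zatoms a env
  | @GRing.add _ ?a ?b => let env1 := zatoms a env in zatoms b env1
  | _ => zatom t env
  end.

Ltac zindex x env :=
  lazymatch env with
  | cons x _ => constr:(0%N)
  | cons _ ?env1 => let n := zindex x env1 in constr:(S n)
  end.

Ltac zreify t env :=
  lazymatch t with
  | @GRing.zero _ => constr:(ZZero)
  | @GRing.opp _ ?a => let e := zreify a env in constr:(ZOpp e)
  | @GRing.add _ ?a ?b =>
    let e1 := zreify a env in let e2 := zreify b env in constr:(ZAdd e1 e2)
  | _ => let n := zindex t env in constr:(ZVar n)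
  end.

(** Proves equations valid in every abelian group; a subterm that is not a zero, an opposite or a
    sum counts as an atom, and the coefficients are compared by computation. *)
Ltac zmod :=
  lazymatch goal with
  | |- @eq ?T ?a ?b =>
    let env0 := zatoms a (@nil T) in
    let env := zatoms b env0 in
    let e1 := zreify a env in
    let e2 := zreify b env in
    refine (@zeval_eq _ env e1 e2 _); vm_compute; reflexivity
  end.

(** Reduces a goal to a formal identity for [zmod]: [u = v] is a combination of known equations,
    assembled with [eqD] and [eqB]. *)
Lemma eq_of_diff (V : zmodType) (u v a b : V) : u = v -> a - b = u - v -> a = b.
Proof. by move=> -> /eqP; rewrite subrr subr_eq0 => /eqP. Qed.

Lemma eqD (V : zmodType) (a b c d : V) : a = b -> c = d -> a + c = b + d.
Proof. by move=> -> ->. Qed.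

Lemma eqB (V : zmodType) (a b c d : V) : a = b -> c = d -> a - c = b - d.
Proof. by move=> -> ->. Qed.

(** * Modules given by generators and relations *)

(** Membership in [submod_gen] quantifies over all submodules containing [A]; [P], packed as a
    submodule, is one of them. *)
Lemma submod_gen_ind (k : pzRingType) (V : lmodType k) (A : set V)
    (P : V -> Prop) :
  P 0 -> (forall c x y, P x -> P y -> P (c *: x + y)) ->
  (forall a, A a -> P a) -> forall x, x \in submod_gen A -> P x.
Proof.
move=> P0 PZD PA x /submod_genP Ax.
have SP : submod_closed (fun v => `[< P v >] : bool).
  by split=> [|c u v /asboolP Pu /asboolP Pv]; apply/asboolP; [|exact: PZD].
pose S := HB.pack_for (submodClosed V) (fun v => `[< P v >] : bool)
  (GRing.isSubmodClosed.Build k V _ SP).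
by apply/asboolP; apply: (Ax S) => a /PA Pa; apply/asboolP.
Qed.

Lemma submod_gen_eq0 (k : pzRingType) (V W : lmodType k) (f : {linear V -> W})
    (A : set V) :
  (forall a, A a -> f a = 0) -> forall x, x \in submod_gen A -> f x = 0.
Proof.
move=> fA; apply: submod_gen_ind => //; first exact: linear0.
by move=> c x y fx fy; rewrite linearP fx fy scaler0 addr0.
Qed.

Section QuotLift.
Variables (k : pzRingType) (V W : lmodType k) (A : set V).
Variable f : {linear V -> W}.
Hypothesis fA : forall a, A a -> f a = 0.

(** The value at a class is [f] at a chosen representative; representatives differ by an element of
    the generated submodule, which [f] kills. *)
Lemma quot_lift_ex :
  exists g : {linear quotmod (submod_gen A) -> W},
    forall x, g (to_quot _ x) = f x.
Proof.
pose h (q : quotmod (submod_gen A)) := f (projT1 (cid (to_quot_surj q))).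
have hE x : h (to_quot _ x) = f x.
  rewrite /h; case: cid => y /= /to_quot_eq /(submod_gen_eq0 fA).
  by rewrite linearB => /eqP; rewrite subr_eq0 => /eqP.
have hlin : linear h.
  move=> c p q; have [x <-] := to_quot_surj p; have [y <-] := to_quot_surj q.
  by rewrite -linearP !hE linearP.
by exists (HB.pack_for {linear quotmod (submod_gen A) -> W} h
  (GRing.isLinear.Build k _ _ _ h hlin)).
Qed.

End QuotLift.

Section FinsuppLift.
Variables (k : pzRingType) (T : choiceType) (M : lmodType k).
Implicit Types x y : finsupp T M.

Lemma singleP (t : T) c (m n : M) :
  single t (c *: m + n) = c *: single t m + single t n.
Proof.
apply: finsupp_eq => u; rewrite /entry /= /GRing.scale/= /GRing.add /=.
by case: eqP => //; rewrite scaler0 addr0.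
Qed.

HB.instance Definition _ (t : T) := GRing.isLinear.Build k M (finsupp T M) _
  (@single k T M t) (@singleP t).

Definition fset_supp x : {fset T} := fset_set [set t | entry x t != 0]%classic.

Lemma fset_suppPn x t : t \notin fset_supp x -> entry x t = 0.
Proof.
apply: contraNeq => xt; rewrite in_fset_set; first exact: mem_set.
exact: entry_finite.
Qed.

Lemma finsupp_ind (P : finsupp T M -> Prop) :
  P 0 -> (forall x y, P x -> P y -> P (x + y)) ->
  (forall t m, P (single t m)) -> forall x, P x.
Proof.
move=> P0 PD P1 x.
have -> : x = \sum_(t <- fset_supp x) single t (entry x t).
  apply: finsupp_eq => u.
  rewrite (big_morph (fun y : finsupp T M => entry y u)
    (op1 := +%R) (id1 := 0)) //.
  have [us|us] := boolP (u \in fset_supp x).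
    rewrite (big_fsetD1 u) //= /entry /= eqxx big1_fset ?addr0 // => t.
    by rewrite !inE => /andP[/negPf]; rewrite eq_sym => ->.
  rewrite big1_fset => [|t ts _].
    by rewrite (fset_suppPn us).
  by rewrite /entry /=; case: eqP ts us => // -> ->.
by apply: (big_ind P).
Qed.

(** Additivity suffices here, so the lemma applies to a multi-additive expression one argument at a
    time. *)
Lemma finsupp_additive_eq0 (W : zmodType) (h : finsupp T M -> W) :
  {morph h : x y / x + y} -> (forall t m, h (single t m) = 0) ->
  forall x, h x = 0.
Proof.
move=> hD h1; apply: finsupp_ind => // [|x y hx hy].
  by apply: (addrI (h 0)); rewrite -hD !addr0.
by rewrite hD hx hy addr0.
Qed.

Variables (W : lmodType k) (f : T -> M -> W).
Hypothesis f_lin : forall t, linear (f t).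

(** Universal property of the direct sum. The support varies with the vector, so [hE] lets the sum
    run over any finite set containing it; linearity is then checked over one common set. *)
Lemma finsupp_lift_ex :
  exists g : {linear finsupp T M -> W}, forall t m, g (single t m) = f t m.
Proof.
pose h x := \sum_(t <- fset_supp x) f t (entry x t).
have hE (A : {fset T}) x : fset_supp x `<=` A ->
    h x = \sum_(t <- A) f t (entry x t).
  move=> sxA; apply: big_fset_incl => // t _ /fset_suppPn ->.
  by apply: (addrI (f t 0)); rewrite -{1}[f t 0]scale1r -f_lin scaler0 !addr0.
have hlin : linear h.
  move=> c x y; pose A := fset_supp x `|` fset_supp y `|` fset_supp (c *: x + y).
  have [sx sy sxy] : [/\ fset_supp x `<=` A, fset_supp y `<=` A
      & fset_supp (c *: x + y) `<=` A].
    split; first by rewrite /A -fsetUA fsubsetUl.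
      by rewrite /A (fsetUC (fset_supp x)) -fsetUA fsubsetUl.
    by rewrite /A fsubsetUr.
  rewrite !(hE A) // scaler_sumr -big_split; apply: eq_bigr => t _.
  exact: f_lin.
exists (HB.pack_for {linear finsupp T M -> W} h
  (GRing.isLinear.Build k _ _ _ h hlin)) => t m /=.
rewrite (hE [fset t]) ?big_seq_fset1 /= /entry /= ?eqxx //.
apply/fsubsetP => u; apply: contraLR; rewrite inE => ut.
rewrite in_fset_set; last exact: entry_finite.
apply: contraNN ut => /set_mem; rewrite /entry /=.
by case: (u =P t) => // _ /eqP.
Qed.

End FinsuppLift.

Section TensLift.
Variables (k : comPzRingType) (M N W : lmodType k) (b : M -> N -> W).
Hypotheses (bDl : forall x x' y, b (x + x') y = b x y + b x' y)
  (bDr : forall x y y', b x (y + y') = b x y + b x y')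
  (bZl : forall c x y, b (c *: x) y = c *: b x y)
  (bZr : forall c x y, b x (c *: y) = c *: b x y).

(** Universal property of the tensor product: each hypothesis on [b] kills one of the four families
    of [tens_rel]. *)
Lemma tens_lift_ex :
  exists g : {linear tens M N -> W}, forall x y, g (x ⊗ y) = b x y.
Proof.
have blin (p : M * N) : linear (fun c : k^o => c *: b p.1 p.2).
  by move=> c u v; rewrite scalerDl scalerA.
have [g0 g0E] := finsupp_lift_ex blin.
have g0E1 x y : g0 (single (x, y) (1 : k^o)) = b x y by rewrite g0E /= scale1r.
have [t tE|g gE] := @quot_lift_ex k _ W (@tens_rel k M N) g0; last first.
  by exists g => x y; rewrite gE g0E1.
case: tE => [[[|]|]|]; move=> [x [y [z ->]]].
- by rewrite !linearB /= !g0E1 bDl addrAC addrK subrr.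
- by rewrite !linearB /= !g0E1 bDr addrAC addrK subrr.
- by rewrite linearB linearZ /= !g0E1 bZl subrr.
- by rewrite linearB linearZ /= !g0E1 bZr subrr.
Qed.

End TensLift.

Lemma tens_ind (k : comPzRingType) (M N : lmodType k) (P : tens M N -> Prop) :
  P 0 -> (forall x y, P x -> P y -> P (x + y)) ->
  (forall x y, P (x ⊗ y)) -> forall t, P t.
Proof.
move=> P0 PD P1 t; have [x <-] := to_quot_surj t.
elim/finsupp_ind: x => [|x y Px Py|[x y] c].
- by rewrite linear0.
- by rewrite linearD; apply: PD.
(* The coefficient is absorbed into the first factor, so pure tensors generate additively. *)
- have -> : single (x, y) (c : k^o) = c *: single (x, y) (1 : k^o).
    by rewrite -linearZ /= /GRing.scale /= mulr1.
  suff e : (c *: x) ⊗ y = to_quot _ (c *: single (x, y) (1 : k^o)).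
    exact: (eq_ind _ P (P1 (c *: x) y) _ e).
  by rewrite tpureZl; exact/esym/linearZ.
Qed.

(** * Associators in alternative algebras *)

Section AlternativeIdentities.
Variables (k : comPzRingType) (D : nonassocAlgType k).
Hypothesis alt : alternative D.
Implicit Types a b c d : D.

Lemma nmulNl a b : (- a) ∙ b = - (a ∙ b).
Proof. by rewrite -scaleN1r nmulZl scaleN1r. Qed.

Lemma nmulNr a b : a ∙ (- b) = - (a ∙ b).
Proof. by rewrite -scaleN1r nmulZr scaleN1r. Qed.

Definition nmulE := (@nmulDl k D, @nmulDr k D, nmulNl, nmulNr).

(** Polarization of [associator a a c = 0] at [a + b]. *)
Lemma associatorC12 a b c : associator a b c = - associator b a c.
Proof.
have := (alt (a + b) c).1; have := (alt a c).1; have := (alt b c).1.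
rewrite /associator !nmulE => eb ea eab.
apply: (eq_of_diff (eqB eab (eqD ea eb))); zmod.
Qed.

Lemma associatorC23 a b c : associator a b c = - associator a c b.
Proof.
have := (alt (b + c) a).2; have := (alt b a).2; have := (alt c a).2.
rewrite /associator !nmulE => eb ea eab.
apply: (eq_of_diff (eqB eab (eqD ea eb))); zmod.
Qed.

Lemma associatorC a b c : associator a b c = associator b c a.
Proof. by rewrite associatorC12 associatorC23 opprK. Qed.

(** The Teichmüller identity: once the associators are expanded, all products cancel. *)
Lemma associator_Teichmuller a b c d :
  associator (a ∙ b) c d - associator a (b ∙ c) d + associator a b (c ∙ d) =
  a ∙ associator b c d + associator a b c ∙ d.
Proof. by rewrite /associator !nmulE; zmod. Qed.

(** Kleinfeld's function; the lemmas below show that it changes sign under transpositions of its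
    arguments. *)
Definition kleinfeld a b c d : D :=
  associator (a ∙ b) c d - b ∙ associator a c d - associator b c d ∙ a.

(** Add the Teichmüller identities for [a b c d] and [b c d a]: the associators containing [b ∙ c]
    or [c ∙ d] cancel after a cyclic rotation. *)
Lemma kleinfeld_shift a b c d : kleinfeld a b c d = - kleinfeld d a b c.
Proof.
have T1 := associator_Teichmuller a b c d.
have T2 := associator_Teichmuller b c d a.
rewrite /kleinfeld; apply: (eq_of_diff (eqD T1 T2)).
rewrite (associatorC a (b ∙ c) d) (associatorC a b (c ∙ d)).
rewrite (associatorC b (c ∙ d) a) (associatorC b c (d ∙ a)).
rewrite (associatorC c (d ∙ a) b) (associatorC d b c) (associatorC a c d).
zmod.
Qed.

Lemma kleinfeldC34 a b c d : kleinfeld a b c d = - kleinfeld a b d c.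
Proof.
by rewrite /kleinfeld (associatorC23 _ c d) (associatorC23 a c d)
  (associatorC23 b c d) !nmulE; zmod.
Qed.

(** Two cyclic shifts carry the first two arguments to the last two, where [kleinfeldC34]
    applies. *)
Lemma kleinfeldC12 a b c d : kleinfeld a b c d = - kleinfeld b a c d.
Proof.
rewrite (kleinfeld_shift a) (kleinfeld_shift d) kleinfeldC34.
by rewrite (kleinfeld_shift c) (kleinfeld_shift a) !opprK.
Qed.

Lemma kleinfeldC23 a b c d : kleinfeld a b c d = - kleinfeld a c b d.
Proof.
by rewrite (kleinfeld_shift a) kleinfeldC34 (kleinfeld_shift a c) opprK.
Qed.

Lemma kleinfeldC13 a b c d : kleinfeld a b c d = - kleinfeld c b a d.
Proof.
by rewrite kleinfeldC12 kleinfeldC23 (kleinfeldC12 b c) opprK.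
Qed.

(** With the products rotated to the front, this is the sum of two instances of [kleinfeldC13]; the
    remaining terms cancel in pairs by skew-symmetry of the associator. *)
Lemma associator_middle_mul a b c d :
  associator a (b ∙ c) d + associator c (d ∙ a) b +
  associator c (b ∙ a) d + associator a (d ∙ c) b = 0.
Proof.
rewrite 4!(associatorC _ (_ ∙ _)).
have := kleinfeldC13 b c d a; have := kleinfeldC13 d a b c.
rewrite /kleinfeld => e1 e2.
apply: (eq_of_diff (eqD e1 e2)).
rewrite (associatorC12 b d a) (associatorC12 b d c) (associatorC12 c b a).
rewrite (associatorC a b c) (associatorC12 c d a) (associatorC a d c).
by rewrite !nmulE; zmod.
Qed.

(** [associator_middle_mul] with [c = a] and [d = b] only shows that four times this element
    vanishes. Instead, exchanging the middle arguments of [kleinfeld b a b a] gives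
    [kleinfeld b b a a], all of whose terms are zero. *)
Lemma associator_mul_middle a b : associator (b ∙ a) b a = 0.
Proof.
have := kleinfeldC23 b a b a.
have f0 : kleinfeld b b a a = 0.
  by rewrite /kleinfeld !(alt _ _).2 nmul0l nmul0r !subr0.
have aba : associator a b a = 0 by rewrite associatorC12 (alt a b).2 oppr0.
by rewrite f0 oppr0 /kleinfeld (alt b a).1 aba nmul0l nmul0r !subr0.
Qed.

End AlternativeIdentities.

(** * Relations between the diamonds of degree zero *)

Section MatrixUnits.
Variables (k : comPzRingType) (J : choiceType) (D : nonassocAlgType k).
Implicit Types (i j l : J) (a b c d : D).

Lemma entry_single i j a :
  entry (single i a : finsupp J D) j = if j == i then a else 0.
Proof. by []. Qed.

Lemma fsum_single (F : J -> D) i :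
  (forall j, j != i -> F j = 0) -> (\sum_(j \in [set: J]) F j)%R = F i.
Proof.
move=> F0.
have <- : (\sum_(j \in [set i]%classic) F j)%R = F i by exact: fsbig_set1.
apply/esym/fsbig_widen => // j [_ /=] /eqP.
exact: F0.
Qed.

Lemma row_mul_single i j l a b c :
  row_mul (single i a) (single j b) (single l c) =
  if i == j then single l (a ∙ (b ∙ c)) else 0 :> finsupp J D.
Proof.
apply: finsupp_eq => m; rewrite row_mulE (fsum_single (i := i)); last first.
  by move=> n /negPf ni; rewrite entry_single ni nmul0l.
rewrite !entry_single eqxx; case: eqP => _; last by rewrite nmul0l nmul0r.
by rewrite entry_single; case: eqP => // _; rewrite !nmul0r.
Qed.

Lemma col_mul_single i j l a b c :
  col_mul (single i a) (single j b) (single l c) =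
  if j == l then single i ((a ∙ b) ∙ c) else 0 :> finsupp J D.
Proof.
apply: finsupp_eq => m; rewrite col_mulE (fsum_single (i := l)); last first.
  by move=> n /negPf nl; rewrite (entry_single l n c) nl nmul0r.
rewrite !entry_single eqxx [l == j]eq_sym; case: (j =P l) => _.
  by rewrite entry_single; case: eqP => // _; rewrite !nmul0l.
by rewrite nmul0r nmul0l.
Qed.

Lemma row_mulDm (x y y' z : finsupp J D) :
  row_mul x (y + y') z = row_mul x y z + row_mul x y' z.
Proof.
apply: finsupp_eq => j; rewrite entryD !row_mulE -fsum_split.
- by apply: eq_fsbigr => i _; rewrite entryD nmulDl nmulDr.
- by apply: (finite_entry (x := x)) => i ->; rewrite nmul0l.
- by apply: (finite_entry (x := x)) => i ->; rewrite nmul0l.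
Qed.

Lemma col_mulDm (y x x' w : finsupp J D) :
  col_mul y (x + x') w = col_mul y x w + col_mul y x' w.
Proof.
apply: finsupp_eq => i; rewrite entryD !col_mulE -fsum_split.
- by apply: eq_fsbigr => j _; rewrite entryD nmulDr nmulDl.
- by apply: (finite_entry (x := w)) => j ->; rewrite nmul0r.
- by apply: (finite_entry (x := w)) => j ->; rewrite nmul0r.
Qed.

End MatrixUnits.

Section Diamond.
Variables (k : comPzRingType) (V : quadPair k).
Implicit Types (x u : Vpos V) (y w : Vneg V).

Lemma diamondDl x x' y : diamond (x + x') y = diamond x y + diamond x' y.
Proof. by rewrite /diamond tpureDl linearD. Qed.

Lemma diamondDr x y y' : diamond x (y + y') = diamond x y + diamond x y'.
Proof. by rewrite /diamond tpureDr linearD. Qed.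

Lemma diamondZl r x y : diamond (r *: x) y = r *: diamond x y.
Proof. by rewrite /diamond tpureZl linearZ. Qed.

Lemma diamondZr r x y : diamond x (r *: y) = r *: diamond x y.
Proof. by rewrite /diamond tpureZr linearZ. Qed.

Lemma diamond_delta x y u w :
  diamond (triple_pos x y u) w - diamond u (triple_neg y x w) +
  (diamond (triple_pos u w x) y - diamond x (triple_neg w u y)) = 0.
Proof.
pose pi : {linear tens (Vpos V) (Vneg V) -> uider V} :=
  to_quot (submod_gen (@uider_rel k V)).
suff : pi (delta x y u w + delta u w x y) = 0.
  by rewrite linearD /delta !(linearB pi).
rewrite -[RHS](linear0 pi); apply/to_quot_eq; rewrite subr0.
by apply: mem_submod_gen; left; exists x, y, u, w.
Qed.

End Diamond.

Section DiagonalDiamonds.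
Variables (k : comPzRingType) (J : choiceType) (D : nonassocAlgType k).
Implicit Types (i j l : J) (a b c d : D).

(** The element written [a,b]_j in the overview. *)
Definition ddiamond j a b : uider (rectPair J D) :=
  diamond (V := rectPair J D) (single j a) (single j b).

Lemma ddiamondDl j a a' b :
  ddiamond j (a + a') b = ddiamond j a b + ddiamond j a' b.
Proof. by rewrite /ddiamond linearD diamondDl. Qed.

Lemma ddiamondDr j a b b' :
  ddiamond j a (b + b') = ddiamond j a b + ddiamond j a b'.
Proof. by rewrite /ddiamond linearD diamondDr. Qed.

Lemma ddiamondZl j r a b : ddiamond j (r *: a) b = r *: ddiamond j a b.
Proof. by rewrite /ddiamond linearZ diamondZl. Qed.

Lemma ddiamondZr j r a b : ddiamond j a (r *: b) = r *: ddiamond j a b.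
Proof. by rewrite /ddiamond linearZ diamondZr. Qed.

(** The skew relation when [x], [y] share the index [i] and [u], [w] share [l]: triple products that
    would contract [i] with [l] vanish. *)
Lemma ddiamond_rel1 i l a b c d : i != l ->
  ddiamond l (a ∙ (b ∙ c)) d - ddiamond l c ((d ∙ a) ∙ b) +
  (ddiamond i (c ∙ (d ∙ a)) b - ddiamond i a ((b ∙ c) ∙ d)) = 0.
Proof.
move=> il; have li : (l == i) = false by rewrite eq_sym (negPf il).
have := @diamond_delta k (rectPair J D) (single i a) (single i b)
  (single l c) (single l d).
rewrite !triple_pos_rect !triple_neg_rect !row_mul_single !col_mul_single.
by rewrite !eqxx (negPf il) li !add0r !addr0.
Qed.

(** The crossed pairing: here [x], [w] share [i] and [y], [u] share [l]. *)
Lemma ddiamond_rel2 i l a b c d : i != l ->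
  ddiamond i (c ∙ (b ∙ a)) d - ddiamond l c ((b ∙ a) ∙ d) +
  (ddiamond l (a ∙ (d ∙ c)) b - ddiamond i a ((d ∙ c) ∙ b)) = 0.
Proof.
move=> il; have li : (l == i) = false by rewrite eq_sym (negPf il).
have := @diamond_delta k (rectPair J D) (single i a) (single l b)
  (single l c) (single i d).
rewrite !triple_pos_rect !triple_neg_rect !row_mul_single !col_mul_single.
by rewrite !eqxx (negPf il) li !add0r !addr0.
Qed.

Local Notation one := (@none k D).

(** With three units in [ddiamond_rel1], the two terms at the auxiliary index [i] cancel each
    other. *)
Lemma ddiamond1l i j b : i != j -> ddiamond j one b = ddiamond j b one.
Proof.
move=> ij; have := ddiamond_rel1 one b one one ij.
rewrite !nmul1l !nmul1r => e; apply/esym/(eq_of_diff e); zmod.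
Qed.

(** The future image of [a ⊗ b] under the inverse map. *)
Definition phi j a b := ddiamond j a b - ddiamond j (b ∙ a) one.

Lemma phi_indep i j a b : i != j -> phi i a b = phi j a b.
Proof.
move=> ij; have ji : j != i by rewrite eq_sym.
have := ddiamond_rel2 one one a b ij.
rewrite !nmul1l !nmul1r (ddiamond1l _ ji) => e.
by apply: (eq_of_diff e); rewrite /phi; zmod.
Qed.

(** With units at [a] and [c], [ddiamond_rel1] mixes the indices [i] and [j]; [phi_indep] moves
    everything to [j]. *)
Lemma phi_skew i j a b : i != j -> phi j a b + phi j b a = 0.
Proof.
move=> ij; have ji : j != i by rewrite eq_sym.
have := ddiamond_rel1 one a one b ij.
rewrite !nmul1l !nmul1r (ddiamond1l _ ji) (ddiamond1l _ ij) => e.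
apply: (eq_of_diff (eqB e (phi_indep b a ij))); rewrite /phi; zmod.
Qed.

Lemma phi_cyclic i j a b c : alternative D -> i != j ->
  phi j (a ∙ b) c + phi j (b ∙ c) a + phi j (c ∙ a) b =
  ddiamond i (associator a b c) one + ddiamond j (associator a b c) one.
Proof.
move=> alt ij; have ji : j != i by rewrite eq_sym.
have := ddiamond_rel1 a b one c ij.
rewrite !nmul1l !nmul1r (ddiamond1l _ ij) => e.
(* The relation [e] produces the associator as (b,c,a) at index [i] and as (c,a,b) at index [j]. *)
rewrite {1}(associatorC alt a b c) -(associatorC alt c a b).
have ddB l x y : ddiamond l (x - y) one = ddiamond l x one - ddiamond l y one.
  by rewrite ddiamondDl -(scaleN1r y) ddiamondZl scaleN1r.
apply: (eq_of_diff (eqD (eqB (eqD e (phi_indep a (b ∙ c) ij))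
  (phi_indep (c ∙ a) b ij)) (phi_skew (b ∙ c) a ij))).
rewrite /phi /associator !ddB; zmod.
Qed.

End DiagonalDiamonds.

(** * The presented module *)

Section Presentation.
Variables (k : comPzRingType) (J : choiceType) (D : nonassocAlgType k).
Implicit Types (i j l : J) (a b c d : D).

Local Notation Q := (quotmod (submod_gen (@Urel k J D))).

Definition Upi : {linear (tens D D * finsupp J D)%type -> Q} := to_quot _.

Lemma Upi_eq0 t : Urel t -> Upi t = 0.
Proof.
move=> Ut; rewrite -[RHS](linear0 Upi); apply/to_quot_eq; rewrite subr0.
exact: mem_submod_gen.
Qed.

Lemma UpiD t t' x x' : Upi (t, x) + Upi (t', x') = Upi (t + t', x + x').
Proof. exact/esym/(linearD Upi (t, x) (t', x')). Qed.

Lemma UpiZ r t x : r *: Upi (t, x) = Upi (r *: t, r *: x).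
Proof. exact/esym/(linearZZ Upi r (t, x)). Qed.

Definition qtens a b : Q := Upi (a ⊗ b, 0).
Definition qsingle j a : Q := Upi (0, single j a).

Lemma qtensDl a a' b : qtens (a + a') b = qtens a b + qtens a' b.
Proof. by rewrite UpiD -tpureDl addr0. Qed.

Lemma qtensDr a b b' : qtens a (b + b') = qtens a b + qtens a b'.
Proof. by rewrite UpiD -tpureDr addr0. Qed.

Lemma qtensZl r a b : qtens (r *: a) b = r *: qtens a b.
Proof. by rewrite UpiZ -tpureZl scaler0. Qed.

Lemma qtensZr r a b : qtens a (r *: b) = r *: qtens a b.
Proof. by rewrite UpiZ -tpureZr scaler0. Qed.

Lemma qsingleD j a b : qsingle j (a + b) = qsingle j a + qsingle j b.
Proof. by rewrite UpiD -linearD addr0. Qed.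

Lemma qsingleZ j r a : qsingle j (r *: a) = r *: qsingle j a.
Proof. by rewrite UpiZ -linearZ scaler0. Qed.

Lemma qsingle0 j : qsingle j 0 = 0.
Proof. by rewrite -(scale0r (0 : D)) qsingleZ scale0r. Qed.

Lemma qsingleN j a : qsingle j (- a) = - qsingle j a.
Proof. by rewrite -scaleN1r qsingleZ scaleN1r. Qed.

Lemma qtens_skew a b : qtens a b + qtens b a = 0.
Proof.
by rewrite UpiD addr0; apply: Upi_eq0; left; exists a, b.
Qed.

Lemma qtens_cyclic i j a b c : i != j ->
  qtens (a ∙ b) c + qtens (b ∙ c) a + qtens (c ∙ a) b =
  qsingle i (associator a b c) + qsingle j (associator a b c).
Proof.
move=> /eqP ij; apply/eqP; rewrite -subr_eq0 opprD addrA -!qsingleN.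
rewrite !UpiD !addr0 !add0r !linearN; apply/eqP/Upi_eq0.
by right; exists a, b, c, j, i; split; first exact/nesym.
Qed.

(** The cyclic relation at (a,1,1) has no associator part; subtracting skew-symmetry leaves a single
    [a ⊗ 1]. *)
Lemma qtens1r i j a : i != j -> qtens a (none : D) = 0.
Proof.
move=> ij; have := qtens_cyclic a none none ij.
rewrite /associator !nmul1l !nmul1r subrr => e.
apply: (eq_of_diff (eqB e (qtens_skew a none))).
rewrite !qsingle0; zmod.
Qed.

Definition qdiamond j a b := qtens a b + qsingle j (b ∙ a).

(** The cyclic relations for (a,bc,d) and (c,da,b), taken at a free pair [j], [j'], account for the
    tensor part. The singles at [i] and at [l] each amount to [- A], as [ei] and [el] show. Choosing
    the pair as [i], [l] makes the right side vanish. *)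
Lemma qdiamond_rel i l j j' a b c d : alternative D -> j != j' ->
  let A := associator a (b ∙ c) d + associator c (d ∙ a) b in
  qdiamond l (a ∙ (b ∙ c)) d - qdiamond l c ((d ∙ a) ∙ b) +
  (qdiamond i (c ∙ (d ∙ a)) b - qdiamond i a ((b ∙ c) ∙ d)) =
  qsingle j A + qsingle j' A - qsingle i A - qsingle l A.
Proof.
move=> alt jj A.
have e1 := qtens_cyclic a (b ∙ c) d jj.
have e2 := qtens_cyclic c (d ∙ a) b jj.
have el : A = ((d ∙ a) ∙ b) ∙ c - d ∙ (a ∙ (b ∙ c)).
  rewrite /A -(associatorC alt d a) (associatorC alt c) /associator; zmod.
have ei : A = ((b ∙ c) ∙ d) ∙ a - b ∙ (c ∙ (d ∙ a)).
  rewrite /A (associatorC alt a) -(associatorC alt b c) /associator; zmod.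
rewrite {3}ei {3}el {1 2}/A (qsingleD j) (qsingleD j').
rewrite (qsingleD i) (qsingleD l) !qsingleN.
apply: (eq_of_diff (eqB (eqB (eqD e1 e2) (qtens_skew c ((d ∙ a) ∙ b)))
  (eqD (qtens_skew a ((b ∙ c) ∙ d)) (qtens_skew (d ∙ a) (b ∙ c))))).
rewrite /qdiamond; zmod.
Qed.

Lemma qdiamond_rel_neq i l a b c d : alternative D -> i != l ->
  qdiamond l (a ∙ (b ∙ c)) d - qdiamond l c ((d ∙ a) ∙ b) +
  (qdiamond i (c ∙ (d ∙ a)) b - qdiamond i a ((b ∙ c) ∙ d)) = 0.
Proof. by move=> alt il; rewrite (qdiamond_rel _ _ _ _ _ _ alt il); zmod. Qed.

(** All four indices equal [j], so both pairings contribute. With an auxiliary [i], they leave the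
    differences of the copies at [i] and [j] of [A] and of [B], and [A + B = 0] by
    [associator_middle_mul]. *)
Lemma qdiamond_rel_sum j a b c d : alternative D -> (exists i, i != j) ->
  qdiamond j (a ∙ (b ∙ c)) d - qdiamond j c ((d ∙ a) ∙ b) +
  (qdiamond j (c ∙ (b ∙ a)) d - qdiamond j c ((b ∙ a) ∙ d)) +
  (qdiamond j (c ∙ (d ∙ a)) b - qdiamond j a ((b ∙ c) ∙ d) +
  (qdiamond j (a ∙ (d ∙ c)) b - qdiamond j a ((d ∙ c) ∙ b))) = 0.
Proof.
move=> alt [i ij]; have block := qdiamond_rel _ _ _ _ _ _ alt ij.
pose A := associator a (b ∙ c) d + associator c (d ∙ a) b.
pose B := associator a (d ∙ c) b + associator c (b ∙ a) d.
have AB : A = - B.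
  apply: (eq_of_diff (associator_middle_mul alt a b c d)); rewrite /A /B; zmod.
have := eqD (block j j a b c d) (block j j a d c b).
rewrite -/A -/B AB !qsingleN => e.
apply: (eq_of_diff e); zmod.
Qed.

(** The alternating relation on matrix units with one common index. Its obstruction is twice
    [associator a (b ∙ a) b], zero by [associator_mul_middle]. *)
Lemma qdiamond_rel_alt j a b : alternative D -> (exists i, i != j) ->
  qdiamond j (a ∙ (b ∙ a)) b - qdiamond j a ((b ∙ a) ∙ b) +
  (qdiamond j (a ∙ (b ∙ a)) b - qdiamond j a ((b ∙ a) ∙ b)) = 0.
Proof.
move=> alt [i ij]; rewrite (qdiamond_rel _ _ _ _ _ _ alt ij).
have -> : associator a (b ∙ a) b = 0.
  by rewrite (associatorC alt) associator_mul_middle.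
by rewrite addr0 !qsingle0; zmod.
Qed.

Lemma qform_ex : exists q : finsupp J D -> finsupp J D -> Q,
  [/\ forall x x' y, q (x + x') y = q x y + q x' y,
      forall x y y', q x (y + y') = q x y + q x y',
      forall r x y, q (r *: x) y = r *: q x y,
      forall r x y, q x (r *: y) = r *: q x y &
      forall i j a b, q (single i a) (single j b) =
        if i == j then qdiamond i a b else 0].
Proof.
have lin (y : finsupp J D) i : linear (fun a => qdiamond i a (entry y i)).
  move=> r a b; rewrite /qdiamond qtensDl qtensZl nmulDr nmulZr qsingleD qsingleZ.
  by rewrite scalerDr; zmod.
(* For fixed [y], the lift sums [qdiamond] over the diagonal; additivity and homogeneity in [y]
   follow by induction on [x]. *)
pose g y := projT1 (cid (finsupp_lift_ex (lin y))).
have gE y i a : g y (single i a) = qdiamond i a (entry y i).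
  by rewrite /g; case: cid.
have gD y y' x : g (y + y') x = g y x + g y' x.
  elim/finsupp_ind: x => [|x x' IH IH'|i a]; first by rewrite !linear0 addr0.
    by rewrite !linearD IH IH'; zmod.
  by rewrite !gE entryD /qdiamond qtensDr nmulDl qsingleD; zmod.
have gZ r y x : g (r *: y) x = r *: g y x.
  elim/finsupp_ind: x => [|x x' IH IH'|i a]; first by rewrite !linear0.
    by rewrite !linearD IH IH'.
  rewrite !gE (_ : entry (r *: y) i = r *: entry y i) //.
  by rewrite /qdiamond qtensZr nmulZl qsingleZ scalerDr.
exists (fun x y => g y x); split=> // [x x' y|r x y|i j a b].
- exact: linearD.
- exact: linearZ.
- rewrite gE entry_single; case: eqP => // _.
  by rewrite /qdiamond nmul0l qsingle0 addr0
    -(scale0r (0 : D)) qtensZr scale0r.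
Qed.

End Presentation.

(** * The map from [uider] to the presented module *)

Section UiderToPresentation.
Variables (k : comPzRingType) (J : choiceType) (D : nonassocAlgType k).
Hypotheses (alt : alternative D) (card_J : forall j : J, exists i, i != j).
Implicit Types (i j l : J) (a b c d : D) (x y u w : finsupp J D).

Local Notation Q := (quotmod (submod_gen (@Urel k J D))).

Variable q : finsupp J D -> finsupp J D -> Q.
Hypotheses (qDl : forall x x' y, q (x + x') y = q x y + q x' y)
  (qDr : forall x y y', q x (y + y') = q x y + q x y')
  (qZl : forall r x y, q (r *: x) y = r *: q x y)
  (qZr : forall r x y, q x (r *: y) = r *: q x y)
  (q_single : forall i j a b, q (single i a) (single j b) =
    if i == j then qdiamond i a b else 0).

(** The image under [q] of δ(x,y)(u ⊗ w), with the triple products expanded. *)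
Definition qdelta x y u w : Q :=
  q (row_mul x y u) w + q (row_mul u y x) w -
  (q u (col_mul y x w) + q u (col_mul w x y)).

Lemma qdeltaD1 x x' y u w :
  qdelta (x + x') y u w = qdelta x y u w + qdelta x' y u w.
Proof.
by rewrite /qdelta row_mulDl row_mulDr !col_mulDm !(qDl, qDr); zmod.
Qed.

Lemma qdeltaD2 x y y' u w :
  qdelta x (y + y') u w = qdelta x y u w + qdelta x y' u w.
Proof.
by rewrite /qdelta !row_mulDm col_mulDl col_mulDr !(qDl, qDr); zmod.
Qed.

Lemma qdeltaD3 x y u u' w :
  qdelta x y (u + u') w = qdelta x y u w + qdelta x y u' w.
Proof. by rewrite /qdelta row_mulDl row_mulDr !(qDl, qDr); zmod. Qed.

Lemma qdeltaD4 x y u w w' :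
  qdelta x y u (w + w') = qdelta x y u w + qdelta x y u w'.
Proof. by rewrite /qdelta col_mulDl col_mulDr !(qDl, qDr); zmod. Qed.

Lemma q0l y : q 0 y = 0.
Proof. by rewrite -(scale0r (0 : finsupp J D)) qZl scale0r. Qed.

Lemma q0r x : q x 0 = 0.
Proof. by rewrite -(scale0r (0 : finsupp J D)) qZr scale0r. Qed.

Lemma qdelta_single i j l m a b c d :
  qdelta (single i a) (single j b) (single l c) (single m d) =
  (if (i == j) && (l == m)
   then qdiamond l (a ∙ (b ∙ c)) d - qdiamond l c ((d ∙ a) ∙ b) else 0) +
  (if (l == j) && (i == m)
   then qdiamond i (c ∙ (b ∙ a)) d - qdiamond l c ((b ∙ a) ∙ d) else 0).
Proof.
have qifl (B : bool) x y : q (if B then x else 0) y = if B then q x y else 0.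
  by case: B; rewrite ?q0l.
have qifr (B : bool) x y : q x (if B then y else 0) = if B then q x y else 0.
  by case: B; rewrite ?q0r.
rewrite /qdelta !row_mul_single !col_mul_single !(qifl, qifr) !q_single.
(* Each of the four terms carries two nested index tests; the terms group into the straight and the
   crossed pairing. *)
have key (W : zmodType) (B1 B2 B3 B4 : bool) (s t v z : W) :
    (if B1 then if B2 then s else 0 else 0) +
    (if B3 then if B4 then t else 0 else 0) -
    ((if B4 then if B3 then v else 0 else 0) +
     (if B1 then if B2 then z else 0 else 0)) =
    (if B1 && B2 then s - z else 0) + (if B3 && B4 then t - v else 0).
  by case: B1 B2 B3 B4 => [] [] [] [] /=; zmod.
exact: key.
Qed.

Lemma qdelta_skew x y u w : qdelta x y u w + qdelta u w x y = 0.
Proof.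
move: x; apply: finsupp_additive_eq0 => [x x'|i a].
  by rewrite qdeltaD1 qdeltaD3; zmod.
move: y; apply: finsupp_additive_eq0 => [y y'|j b].
  by rewrite qdeltaD2 qdeltaD4; zmod.
move: u; apply: finsupp_additive_eq0 => [u u'|l c].
  by rewrite qdeltaD1 qdeltaD3; zmod.
move: w; apply: finsupp_additive_eq0 => [w w'|m d].
  by rewrite qdeltaD2 qdeltaD4; zmod.
rewrite !qdelta_single.
(* If exactly one of [i = j], [l = m] holds, neither pairing is possible and both sides of the sum
   vanish. *)
have [->|ij] := eqVneq i j; have [->|lm] := eqVneq l m.
- case: (eqVneq m j) => [->|mj] /=.
    exact: qdiamond_rel_sum alt (card_J j).
  by rewrite !addr0; apply: qdiamond_rel_neq; rewrite // eq_sym.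
- rewrite [(l == j) && _]andbC; suff -> : (j == m) && (l == j) = false.
    by rewrite /= !addr0.
  by apply: contraNF lm => /andP[/eqP <- /eqP <-].
- rewrite [(m == j) && _]andbC; suff -> : (i == m) && (m == j) = false.
    by rewrite /= !addr0.
  by apply: contraNF ij => /andP[/eqP -> /eqP <-].
- rewrite /= [(i == m) && _]andbC !add0r.
  case: andP => [[/eqP lj _]|_]; last by rewrite addr0.
  (* The crossed pairing is the straight relation with [b] and [d] exchanged, up to reordering. *)
  by rewrite addrC addrACA [X in _ + X]addrC addrACA;
    apply: qdiamond_rel_neq => //; rewrite lj.
Qed.

(** The expression is quadratic in [x] and in [y]; [qdelta_skew] kills the cross terms, which leaves
    matrix units. *)
Lemma qdelta_alternating x y : qdelta x y x y = 0.
Proof.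
elim/finsupp_ind: x y => [|x x' IHx IHx'|i a] y.
- by apply: (addrI (qdelta 0 y 0 y)); rewrite -qdeltaD1 !addr0.
- rewrite qdeltaD1 !qdeltaD3.
  apply: (eq_of_diff (eqD (eqD (IHx y) (IHx' y)) (qdelta_skew x y x' y))).
  by zmod.
elim/finsupp_ind: y => [|y y' IHy IHy'|j b].
- apply: (addrI (qdelta (single i a) 0 (single i a) 0)).
  by rewrite -qdeltaD2 !addr0.
- rewrite qdeltaD2 !qdeltaD4.
  apply: (eq_of_diff (eqD (eqD IHy IHy')
    (qdelta_skew (single i a) y (single i a) y'))).
  by zmod.
rewrite qdelta_single; have [->|ij] := eqVneq i j; last by rewrite andbF; zmod.
exact: qdiamond_rel_alt alt (card_J j).
Qed.

Lemma uider_lift_ex : exists g : {linear uider (rectPair J D) -> Q},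
  forall i a b, g (ddiamond i a b) = qdiamond i a b.
Proof.
have [g0 g0E] := tens_lift_ex qDl qDr qZl qZr.
have g0_delta x y u w : g0 (delta (V := rectPair J D) x y u w) = qdelta x y u w.
  by rewrite /delta linearB !g0E triple_pos_rect triple_neg_rect qDl qDr.
have [t|g gE] := @quot_lift_ex k _ Q (@uider_rel k (rectPair J D)) g0.
  case=> [[x [y [u [w ->]]]]|[x [y ->]]].
    by rewrite linearD !g0_delta qdelta_skew.
  by rewrite g0_delta qdelta_alternating.
by exists g => i a b; rewrite gE g0E q_single eqxx.
Qed.

End UiderToPresentation.

(** * The inverse map, from the presented module to [uider] *)

Section PresentationToUider.
Variables (k : comPzRingType) (J : choiceType) (D : nonassocAlgType k).
Hypotheses (alt : alternative D) (card_J : forall j : J, exists i, i != j).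
Implicit Types (i j l : J) (a b c d : D).

Local Notation Q := (quotmod (submod_gen (@Urel k J D))).
Local Notation one := (@none k D).

Lemma presentation_ind (P : Q -> Prop) :
  P 0 -> (forall s t, P s -> P t -> P (s + t)) ->
  (forall a b, P (qtens J a b)) -> (forall j a, P (qsingle j a)) -> forall s, P s.
Proof.
move=> P0 PD Pt Ps s; have [[t x] <-] := to_quot_surj s.
suff: P (Upi J D (t, 0) + Upi J D (0, x)) by rewrite UpiD addr0 add0r.
apply: (PD).
  elim/tens_ind: t => [|t t' Pt0 Pt1|a b]; last exact: Pt.
    by rewrite (_ : (0, 0) = 0) ?linear0.
  by have := PD _ _ Pt0 Pt1; rewrite UpiD addr0.
elim/finsupp_ind: x => [|x x' Px Px'|j a]; last exact: Ps.
  by rewrite (_ : (0, 0) = 0) ?linear0.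
by have := PD _ _ Px Px'; rewrite UpiD addr0.
Qed.

Lemma presentation_lift_ex j0 : exists h : {linear Q -> uider (rectPair J D)},
  (forall a b, h (qtens J a b) = phi j0 a b) /\
  (forall j a, h (qsingle j a) = ddiamond j a one).
Proof.
have [h1 h1E] : exists h1 : {linear tens D D -> uider (rectPair J D)},
    forall a b, h1 (a ⊗ b) = phi j0 a b.
  apply: tens_lift_ex => [a a' b|a b b'|r a b|r a b]; rewrite /phi.
  - by rewrite nmulDr !ddiamondDl; zmod.
  - by rewrite nmulDl ddiamondDl ddiamondDr; zmod.
  - by rewrite nmulZr !ddiamondZl scalerBr.
  - by rewrite nmulZl ddiamondZl ddiamondZr scalerBr.
have lin2 j : linear (fun a => ddiamond j a one).
  by move=> r a b; rewrite ddiamondDl ddiamondZl.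
have [h2 h2E] := finsupp_lift_ex lin2.
pose h0 (p : tens D D * finsupp J D) := h1 p.1 + h2 p.2.
have h0_lin : linear h0.
  by move=> r [t x] [t' x']; rewrite /h0 /= !linearP scalerDr; zmod.
have [i ij] := card_J j0.
have h2N j a : h2 (- single j a) = - ddiamond j a one by rewrite linearN h2E.
have [t Ut|h hE] := @quot_lift_ex k _ _ (@Urel k J D)
  (HB.pack_for {linear (tens D D * finsupp J D)%type -> uider (rectPair J D)} h0
    (GRing.isLinear.Build k _ _ _ h0 h0_lin)).
  rewrite /= /h0; case: Ut => [[a [b ->]]|[a [b [c [j [j' [/eqP jj' ->]]]]]]] /=.
    by rewrite linear0 addr0 linearD !h1E (phi_skew _ _ ij).
  rewrite [h2 _](linearB h2) h2N h2E.
  rewrite !(linearD h1) !h1E.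
  (* The relation in [U] involves an arbitrary pair [j], [j'], so [phi] is moved from the fixed [j0]
     to [j]. *)
  have ji l : phi j0 = phi l :> (D -> D -> uider (rectPair J D)).
    apply/funext => a1; apply/funext => b1.
    by have [->//|/phi_indep] := eqVneq j0 l; exact.
  by rewrite (ji j) (phi_cyclic _ _ _ alt (i := j')) 1?eq_sym //; zmod.
exists h; split=> [a b|j a]; rewrite hE /= /h0 /=.
  by rewrite linear0 addr0 h1E.
by rewrite linear0 add0r h2E.
Qed.

End PresentationToUider.

Theorem proposition6p2p10 (k : comPzRingType) (J : choiceType)
    (D : nonassocAlgType k)
    (card_J_ge2 : exists i j : J, i <> j)
    (D_alternative : alternative D)
    (D_associative : (exists i j l : J, [/\ i <> j, i <> l & j <> l]) ->
                     associative (@nmul k D)) :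
  exists f : {linear uider0 J D -> quotmod (submod_gen (@Urel k J D))}, bijective f.
Proof.
have [j0 [j1 /eqP j01]] := card_J_ge2.
have card_J (j : J) : exists i, i != j.
  by have [<-|] := eqVneq j0 j; [exists j1; rewrite eq_sym|exists j0].
have [q [qDl qDr qZl qZr q_single]] := qform_ex J D.
have [g gE] := uider_lift_ex D_alternative card_J qDl qDr qZl qZr q_single.
have [h [h_tens h_single]] := presentation_lift_ex D_alternative card_J j0.
have hg i a b : h (qdiamond i a b) = ddiamond i a b.
  rewrite linearD h_tens h_single.
  have [<-|/phi_indep ->] := eqVneq j0 i; exact: subrK.
(* On [a ⊗ b] the copies of [b ∙ a] at [j0] cancel, and the extra tensor of [b ∙ a] with the unit is
   zero by [qtens1r]. *)
have gh s : g (h s) = s.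
  elim/presentation_ind: s => [|s t IHs IHt|a b|j a]; first by rewrite !linear0.
  - by rewrite !linearD IHs IHt.
  - rewrite h_tens linearB !gE /qdiamond nmul1l (qtens1r _ j01).
    by zmod.
  - by rewrite h_single gE /qdiamond (qtens1r _ j01) nmul1l add0r.
set S := [set d : uider (rectPair J D) | exists (j : J) (a b : D),
  d = diamond (V := rectPair J D) (single j a) (single j b)]%classic.
have S_ddiamond j a b : ddiamond j a b \in submod_gen S.
  by apply: mem_submod_gen; exists j, a, b.
(* The values of [h] have degree zero, so [h] corestricts to an inverse of the restriction of
   [g]. *)
have hS s : h s \in submod_gen S.
  elim/presentation_ind: s => [|s t IHs IHt|a b|j a].
  - by rewrite linear0 rpred0.
  - by rewrite linearD rpredD.
  - by rewrite h_tens rpredB.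
  - by rewrite h_single.
exists (g \o (val : uider0 J D -> uider (rectPair J D))).
exists (fun s => Submod (hS s)) => [[d dS]|s] /=; last exact: gh.
apply: val_inj => /=; move: d dS.
(* [hg] gives the other composite on the diagonal diamonds, hence on their span. *)
apply: submod_gen_ind => [|c d d' IH IH'|_ [j [a [b ->]]]].
- by rewrite !linear0.
- by rewrite !linearP IH IH'.
- by rewrite gE hg.
Qed.
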